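(* Let $A$ and $B$ be two points in $\mathbb{R}^3$, and for every $t\in[-1,1]$ let $A_t,B_t$ be the corresponding points in $E_t$. The limit as $t\to 0$, $t>0$ (respectively $t<0$), of the distance from $A_t$ to $B_t$ in $E_t$ normalized by the factor $1/\sqrt{t}$ is equal to the Euclidean distance between $A_0$ and $B_0$.
   Context: For $t\in[-1,1]$ let $q_t(x,y,z)=tx^2+ty^2+z^2$ on $\mathbb{R}^3$, and for $t\neq 0$ let $\beta_t(u,v)=\frac{1}{2}\big(q_t(u+v)-q_t(u)-q_t(v)\big)$ be the associated bilinear form. The space $E_t$ is modeled as $S_t/\mathbb{Z}_2$, where $S_t=\{(x,y,z)\in\mathbb{R}^3 \mid tx^2+ty^2+z^2=1\}$ and $\mathbb{Z}_2$ acts by sending a vector to its opposite. For $t>0$ this is a spherical (elliptic) geometry, for $t<0$ a hyperbolic geometry, and for $t=0$ the Euclidean plane; $S_0$ is the union of the two planes $z=1$ and $z=-1$, which are identified in the quotient $E_0$. Any vector in $\mathbb{R}^3$ defines a point in each geometry $E_t$ by taking the intersection of the ray containing it with $S_t$ (or the image of this intersection in the quotient by $\mathbb{Z}_2$); $A_t$ and $B_t$ are the points of $E_t$ defined in this way by $A$ and $B$. For $t\neq 0$, the distance from $x_t$ to $y_t$ in $E_t$, before normalization, is the angular distance $$w_t(x_t,y_t)=\arccos\frac{\beta_t(x_t,y_t)}{\sqrt{q_t(x_t)}\sqrt{q_t(y_t)}}.$$ Normalizing by the factor $1/\sqrt{t}$ means multiplying $w_t$ by $1/\sqrt{t}$.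 *)

(* Defs.v *)
From HB Require Import structures.
From mathcomp Require Import all_boot all_order all_algebra.
From mathcomp Require Import complex.
From mathcomp Require Import ring lra.
From mathcomp Require Import all_classical all_reals all_analysis.

Set Implicit Arguments.
Unset Strict Implicit.
Unset Printing Implicit Defensive.

Import Order.TTheory GRing.Theory Num.Theory.
Import numFieldNormedType.Exports.

Local Open Scope classical_set_scope.
Local Open Scope ring_scope.
Local Open Scope complex_scope.
Local Open Scope quotient_scope.

Section ComplexFunctions.
Variable R : realType.
Implicit Type z : R[i].

(* Principal argument, in ]-pi, pi]. *)
Definition carg z : R :=
  let a := acos (complex.Re z / Normc.normc z) in
  if 0 <= complex.Im z then a else - a.

Definition clog z : R[i] := ln (Normc.normc z) +i* carg z.

(* Principal determination.  On [-1, 1] this is the real arc cosine; for real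
   c > 1 it is 'i * arcosh c. *)
Definition carccos z : R[i] := - 'i * clog (z + 'i * sqrtc (1 - z ^+ 2)).

Lemma carccos_acos (c : R) : -1 <= c <= 1 -> carccos c%:C = (acos c)%:C.
Proof.
move=> c1; have c2 : 0 <= 1 - c ^+ 2 by move/andP: c1 => [? ?]; nra.
rewrite /carccos.
have -> : 1 - c%:C ^+ 2 = (1 - c ^+ 2)%:C :> R[i] by rewrite rmorphB rmorphXn.
rewrite sqrtc_sqrtr ?lecR //=.
have -> : c%:C + 'i * (Num.sqrt (1 - c ^+ 2))%:C
          = c +i* Num.sqrt (1 - c ^+ 2) by simpc.
rewrite /clog /carg /= sqrtr_ge0 sqr_sqrtr // addrC subrK sqrtr1 divr1 ln1.
by simpc.
Qed.

Lemma carccos_arcosh (c : R) : 1 <= c ->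
  carccos c%:C = 'i * (ln (c + Num.sqrt (c ^+ 2 - 1)))%:C.
Proof.
move=> c1; have c2 : 0 <= c ^+ 2 - 1 by nra.
set s := Num.sqrt _; have s2 : s ^+ 2 = c ^+ 2 - 1 by rewrite sqr_sqrtr.
have s_ge0 : 0 <= s by exact: sqrtr_ge0.
have sc : s < c by nra.
have sqE : sqrtc (1 - c%:C ^+ 2) = 'i * s%:C :> R[i].
  have -> : 1 - c%:C ^+ 2 = (- s ^+ 2)%:C :> R[i].
    by rewrite s2 opprB rmorphB rmorphXn.
  rewrite /sqrtc /= eqxx expr0n addr0 sqrtr_sqr normrN ger0_norm ?sqr_ge0 //=.
  rewrite subrr mul0r sqrtr0 opprK.
  have -> : (s ^+ 2 + s ^+ 2) / 2 = s ^+ 2 by lra.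
  by rewrite sqrtr_sqr ger0_norm //; simpc.
rewrite /carccos sqE.
have -> : c%:C + 'i * ('i * s%:C) = (c - s)%:C :> R[i] by simpc.
have cs0 : 0 < c - s by rewrite subr_gt0.
rewrite /clog /carg /= lexx expr0n addr0 sqrtr_sqr gtr0_norm //.
rewrite divff ?gt_eqF // acos1.
have -> : c + s = (c - s)^-1.
  by apply: (mulIf (lt0r_neq0 cs0)); rewrite mulVf ?lt0r_neq0 //; lra.
by rewrite lnV ?posrE //; simpc.
Qed.

End ComplexFunctions.

Section Geometries.
Variable R : realType.

Definition qform (t : R) (u : 'rV[R]_3) : R :=
  t * u 0 0 ^+ 2 + t * u 0 1 ^+ 2 + u 0 2 ^+ 2.

Definition bform (t : R) (u v : 'rV[R]_3) : R :=
  2^-1 * (qform t (u + v) - qform t u - qform t v).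

Definition model (t : R) : Type := {u : 'rV[R]_3 | qform t u == 1}.
HB.instance Definition _ t := Choice.on (model t).

Definition antipodal (t : R) : rel (model t) :=
  fun u v => (val u == val v) || (val u == - val v).

Lemma antipodal_refl t : reflexive (@antipodal t).
Proof. by move=> u; rewrite /antipodal eqxx. Qed.

Lemma antipodal_sym t : symmetric (@antipodal t).
Proof.
by move=> u v; rewrite /antipodal eq_sym [X in _ || X]eq_sym eqr_oppLR.
Qed.

Lemma antipodal_trans t : transitive (@antipodal t).
Proof.
move=> v u w /orP[]/eqP uv /orP[]/eqP vw;
  by rewrite /antipodal uv vw ?opprK eqxx ?orbT.
Qed.

Canonical antipodal_equiv t :=
  EquivRel (@antipodal t) (@antipodal_refl t) (@antipodal_sym t)
           (@antipodal_trans t).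

Definition geom (t : R) : Type := {eq_quot (antipodal_equiv t)}.
HB.instance Definition _ t := Choice.on (geom t).
HB.instance Definition _ t := EqQuotient.on (geom t).

Definition ray_point (t : R) (A : 'rV[R]_3) (P : geom t) : Prop :=
  exists s : model t, (exists2 l : R, 0 < l & val s = l *: A) /\ P = \pi_(geom t) s.

(* For t < 0, bform t u v / (sqrt (qform t u) * sqrt (qform t v)) can be > 1,
   hence the complex arc cosine. *)
Definition angle (t : R) (u v : 'rV[R]_3) : R[i] :=
  carccos (bform t u v / (Num.sqrt (qform t u) * Num.sqrt (qform t v)))%:C.

(* [angle] depends on the lifts: replacing v by - v turns an angle into its
   supplement.  The quotient distance is attained at lifts p, q such that
   0 <= bform t p q: for t > 0 they give the smaller of the two supplementary
   angles, and for t < 0 they lie on the same sheet of [model t]. *)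
Definition geom_dist (t : R) (P Q : geom t) : R[i] :=
  let p := val (repr P) in
  let q := val (repr Q) in
  angle t p (if 0 <= bform t p q then q else - q).

Definition normalized_dist (t : R) (P Q : geom t) : R[i] :=
  1 / sqrtc t%:C * geom_dist P Q.

(* The lift in the plane z = 1; the third coordinate of [repr P] is 1 or -1. *)
Definition lift0 (P : geom 0) : 'rV[R]_3 := val (repr P) 0 2 *: val (repr P).

Definition euclid_dist0 (P Q : geom 0) : R :=
  Num.sqrt (\sum_(i < 3) (lift0 P 0 i - lift0 Q 0 i) ^+ 2).

Lemma bformNr t u v : bform t u (- v) = - bform t u v.
Proof. rewrite /bform /qform !mxE; lra. Qed.

Lemma bformNl t u v : bform t (- u) v = - bform t u v.
Proof. rewrite /bform /qform !mxE; lra. Qed.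

Lemma qformN t u : qform t (- u) = qform t u.
Proof. by rewrite /qform !mxE !sqrrN. Qed.

Lemma angleNN t u v : angle t (- u) (- v) = angle t u v.
Proof. by rewrite /angle bformNl bformNr opprK !qformN. Qed.

Lemma repr_pi t (u : model t) :
  val (repr (\pi_(geom t) u)) = val u \/ val (repr (\pi_(geom t) u)) = - val u.
Proof.
have /eqmodP : repr (\pi_(geom t) u) = u %[mod geom t] by rewrite reprK.
by rewrite /= /antipodal => /orP[]/eqP ->; [left|right].
Qed.

Lemma geom_dist_pi t (u v : model t) : 0 <= bform t (val u) (val v) ->
  geom_dist (\pi_(geom t) u) (\pi_(geom t) v) = angle t (val u) (val v).
Proof.
rewrite /geom_dist => b_ge0; set b := bform t (val u) (val v) in b_ge0.
have b0 : 0 <= - b -> angle t (val u) (- val v) = angle t (val u) (val v).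
  rewrite oppr_ge0 => b_le0; have b0 : b = 0 by apply/le_anti/andP.
  by rewrite /angle bformNr -/b b0 oppr0 !mul0r.
have b0' : 0 <= - b -> angle t (- val u) (val v) = angle t (val u) (val v).
  by move=> Hb; rewrite -[in LHS](opprK (val v)) angleNN b0.
by case: (repr_pi u) => ->; case: (repr_pi v) => ->;
  rewrite ?bformNl ?bformNr ?opprK -/b ?b_ge0 ?angleNN //; case: ifPn => // Hb;
  rewrite ?angleNN ?b0 ?b0'.
Qed.

Lemma lift0_pi (u : model 0) : val u 0 2 = 1 -> lift0 (\pi_(geom 0) u) = val u.
Proof.
by rewrite /lift0 => u1; case: (repr_pi u) => ->;
  rewrite ?mxE u1 ?scale1r // scaleN1r opprK.
Qed.

End Geometries.

(* Main.v *)
Require Import Defs.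
From HB Require Import structures.
From mathcomp Require Import all_boot all_order all_algebra.
From mathcomp Require Import complex.
From mathcomp Require Import ring lra.
From mathcomp Require Import all_classical all_reals all_analysis.

Set Implicit Arguments.
Unset Strict Implicit.
Unset Printing Implicit Defensive.

Import Order.TTheory GRing.Theory Num.Theory.
Import numFieldNormedType.Exports.

Local Open Scope classical_set_scope.
Local Open Scope ring_scope.
Local Open Scope complex_scope.
Local Open Scope quotient_scope.

(** Rescale A and B to representatives (a, 1) and (b, 1), with a and b in the
    plane.  The cosine c of the angle between A_t and B_t then satisfies
    1 - c^2 = t w^2, where w^2 is the quotient of
    |a - b|^2 + t (|a|^2 |b|^2 - <a, b>^2) by (1 + t |a|^2) (1 + t |b|^2), so
    that w tends to |a - b|.  For t > 0 the angle is the arc tangent of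
    sqrt t * w / c; for t < 0 it is i times the logarithm of
    c + sqrt (- t) * w.  Both are equivalent to w times the square root of t. *)

(** * Elementary bounds and the two limits they squeeze *)

(** By the mean value theorem [atan x] is [x / (1 + y ^+ 2)] for some [y] between 0 and [x]. *)
Lemma atan_bounds (R : realType) (x : R) : 0 <= x ->
  x / (1 + x ^+ 2) <= atan x <= x.
Proof.
move=> x_ge0.
have [|y] := @MVT_segment R (@atan R) (fun z => (1 + z ^+ 2)^-1) 0 x x_ge0.
  by apply: continuous_subspaceT => z; exact: continuous_atan.
rewrite in_itv/= => /andP[y_ge0 yx]; rewrite atan0 !subr0 => ->.
have y2 : 0 < 1 + y ^+ 2 by nra.
rewrite mulrC ler_wpM2r//=; last by rewrite lef_pV2 ?posrE//; nra.
by rewrite ler_piMl// invf_le1//; nra.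
Qed.

Lemma ln1D_bounds (R : realType) (u : R) : 0 <= u ->
  u / (1 + u) <= ln (1 + u) <= u.
Proof.
move=> u_ge0; have u1 : 0 < 1 + u by lra.
rewrite le_ln1Dx ?andbT; last by lra.
(* The lower bound is the upper bound taken at [(1 + u)^-1 - 1], since the logarithm turns inverses
   into opposites. *)
have /le_ln1Dx : -1 < (1 + u)^-1 - 1 by rewrite ltrBrDr addNr invr_gt0.
rewrite addrC subrK lnV ?posrE//.
suff -> : u / (1 + u) = 1 - (1 + u)^-1 by lra.
by field; lra.
Qed.

Lemma acos_atan (R : realType) (c s : R) : 0 < c -> 0 <= s ->
  c ^+ 2 + s ^+ 2 = 1 -> acos c = atan (s / c).
Proof.
move=> c_gt0 s_ge0 cs.
have cE : c = cos (atan (s / c)).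
  rewrite cos_atan.
  have -> : 1 + (s / c) ^+ 2 = c^-1 ^+ 2.
    by rewrite -[c^-1 ^+ 2]mul1r -[in RHS]cs; field; lra.
  by rewrite sqrtr_sqr ger0_norm ?invrK// invr_ge0 ltW.
rewrite [in LHS]cE cosK// in_itv/= -[X in X <= _]atan0.
rewrite le_atan ?divr_ge0 ?(ltW c_gt0)//=.
by rewrite (le_trans (ltW (atan_ltpi2 _)))// ler_pdivrMr//
  ler_peMr ?pi_ge0// ler1n.
Qed.

Lemma cvg_real_complex (R : realType) (T : Type) (F : set_system T)
    (FF : Filter F) (f : T -> R) (l : R) :
  f @ F --> l -> ((f x)%:C : R[i]^o) @[x --> F] --> (l%:C : R[i]^o).
Proof.
move=> fl; apply/cvgrPdist_lt => -[e e'].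
(* The tolerance is a complex number; being positive, it has zero imaginary part. *)
rewrite ltcE/= => /andP[/eqP e'0 e_gt0].
near=> x.
rewrite -rmorphB/= normc_def/= expr0n/= addr0 sqrtr_sqr ltcE/= e'0 eqxx/=.
near: x.
by move/cvgrPdist_lt : fl; apply.
Unshelve. all: by end_near. Qed.

(** With [r * w] as sine, [acos c] is the arc tangent of [r * w / c]; dividing the bounds on [atan]
    by [r] leaves two functions that tend to [d]. *)
Lemma cvg_acos_div (R : realType) (T : Type) (F : set_system T)
    (FF : Filter F) (r c w : T -> R) (d : R) :
  (\forall x \near F, 0 < r x) -> (\forall x \near F, 0 <= w x) ->
  (\forall x \near F, c x ^+ 2 + (r x * w x) ^+ 2 = 1) ->
  r @ F --> (0 : R) -> c @ F --> (1 : R) -> w @ F --> d ->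
  acos (c x) / r x @[x --> F] --> d.
Proof.
move=> r_gt0 w_ge0 crw r0 c1 wd.
have c_gt0 : \forall x \near F, 0 < c x.
  by apply: (cvgr_gt (1 : R)) => //; exact: ltr01.
have wc : w x / c x @[x --> F] --> d.
  by rewrite -[d]divr1; apply: cvgM => //; exact: cvgV.
apply: (squeeze_cvgr
    (f := fun x => w x / c x / (1 + (r x * w x / c x) ^+ 2)) _ _ wc); last first.
  rewrite -[d in X in _ --> X]divr1 -[X in _ / X]addr0.
  apply: cvgM => //; apply: cvgV; first by rewrite addr0.
  apply: cvgD; first exact: cvg_cst.
  rewrite (_ : 0 = (0 * d / 1) ^+ 2); last by rewrite !mul0r expr0n.
  by apply: cvgM; (apply: cvgM; [exact: cvgM|exact: cvgV]).
near=> x.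
have rx : 0 < r x by near: x.
have wx : 0 <= w x by near: x.
have cx : 0 < c x by near: x.
rewrite (@acos_atan _ (c x) (r x * w x)) ?mulr_ge0 ?(ltW rx)//; last by near: x.
have /atan_bounds/andP[lo up] : 0 <= r x * w x / c x.
  by rewrite divr_ge0 ?mulr_ge0 ?(ltW rx) ?(ltW cx).
rewrite ler_pdivlMr// ler_pdivrMr//; apply/andP; split.
  by rewrite [leLHS]mulrC !mulrA.
by rewrite [leRHS]mulrC mulrA.
Unshelve. all: by end_near. Qed.

Lemma cvg_arcosh_div (R : realType) (T : Type) (F : set_system T)
    (FF : Filter F) (r c w : T -> R) (d : R) :
  (\forall x \near F, 0 < r x) -> (\forall x \near F, 0 <= w x) ->
  (\forall x \near F, c x ^+ 2 = 1 + (r x * w x) ^+ 2) ->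
  r @ F --> (0 : R) -> c @ F --> (1 : R) -> w @ F --> d ->
  ln (c x + Num.sqrt (c x ^+ 2 - 1)) / r x @[x --> F] --> d.
Proof.
move=> r_gt0 w_ge0 crw r0 c1 wd.
have c_gt0 : \forall x \near F, 0 < c x.
  by apply: (cvgr_gt (1 : R)) => //; exact: ltr01.
(* Chosen so that [c + r * w = 1 + r * v]: indeed [c - 1 = (r * w) ^+ 2 / (c + 1)]. The correction
   to [w] vanishes in the limit, and [ln1D_bounds] applies to [r * v]. *)
pose v x := w x + r x * w x ^+ 2 / (c x + 1).
have vd : v x @[x --> F] --> d.
  rewrite -[d]addr0; apply: cvgD => //.
  rewrite (_ : 0 = 0 * d ^+ 2 / (1 + 1)); last by rewrite !mul0r.
  apply: cvgM; first by apply: cvgM => //; exact: cvgM.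
  by apply: cvgV; [rewrite lt0r_neq0// addr_gt0|apply: cvgD => //; exact: cvg_cst].
apply: (squeeze_cvgr (f := fun x => v x / (1 + r x * v x)) _ _ vd); last first.
  rewrite -[d in X in _ --> X]divr1 -[X in _ / X]addr0.
  apply: cvgM => //; apply: cvgV; first by rewrite addr0 oner_eq0.
  apply: cvgD; first exact: cvg_cst.
  by rewrite -(mul0r d); exact: cvgM.
near=> x.
have rx : 0 < r x by near: x.
have wx : 0 <= w x by near: x.
have cx : 0 < c x by near: x.
have cE : c x ^+ 2 = 1 + (r x * w x) ^+ 2 by near: x.
have -> : Num.sqrt (c x ^+ 2 - 1) = r x * w x.
  by rewrite cE addrC addKr sqrtr_sqr ger0_norm// mulr_ge0// ltW.
have -> : c x + r x * w x = 1 + r x * v x.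
  have -> : r x * v x = r x * w x + (r x * w x) ^+ 2 / (c x + 1).
    by rewrite /v; field; lra.
  have -> : (r x * w x) ^+ 2 = c x ^+ 2 - 1 by rewrite cE; ring.
  by field; lra.
have /ln1D_bounds/andP[lo up] : 0 <= r x * v x.
  rewrite mulr_ge0 ?(ltW rx)// addr_ge0// divr_ge0 ?mulr_ge0 ?(ltW rx)//.
  by rewrite addr_ge0 ?(ltW cx).
rewrite ler_pdivlMr// ler_pdivrMr//; apply/andP; split.
  by rewrite [leLHS]mulrC mulrA.
by rewrite [leRHS]mulrC.
Unshelve. all: by end_near. Qed.

(** * Distances in the quotient computed on rays *)

Lemma bformE (R : realType) (t : R) (u v : 'rV[R]_3) :
  bform t u v = t * (u 0 0 * v 0 0 + u 0 1 * v 0 1) + u 0 2 * v 0 2.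
Proof. by rewrite /bform /qform !mxE; field. Qed.

Lemma bformZ (R : realType) (t k l : R) (u v : 'rV[R]_3) :
  bform t (k *: u) (l *: v) = k * l * bform t u v.
Proof. by rewrite !bformE !mxE; ring. Qed.

Lemma qformZ (R : realType) (t k : R) (u : 'rV[R]_3) :
  qform t (k *: u) = k ^+ 2 * qform t u.
Proof. by rewrite /qform !mxE; ring. Qed.

(** A change of sign of a lift only changes the sign of the form, and [geom_dist] selects lifts on
    which the form is nonnegative. *)
Lemma geom_dist_abs (R : realType) (t : R) (u v : model t) :
  geom_dist (\pi_(geom t) u) (\pi_(geom t) v) =
  carccos `|bform t (val u) (val v)|%:C.
Proof.
have q1 (w : model t) : qform t (val w) = 1 by exact/eqP/(svalP w).
rewrite /geom_dist /angle !q1.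
have -> : `|bform t (val u) (val v)| = `|bform t (val (repr (\pi_(geom t) u)))
                                           (val (repr (\pi_(geom t) v)))|.
  by case: (repr_pi u) => ->; case: (repr_pi v) => ->;
    rewrite ?bformNl ?bformNr ?opprK ?normrN.
case: ifPn => [b_ge0|]; first by rewrite q1 sqrtr1 mulr1 divr1 ger0_norm.
rewrite -ltNge => b_lt0.
by rewrite qformN q1 sqrtr1 mulr1 divr1 bformNr ltr0_norm.
Qed.

(** Needed because for [t < 0] a ray may miss the model. *)
Lemma ray_point_ex (R : realType) (t : R) (A : 'rV[R]_3) :
  0 < qform t A -> exists P : geom t, ray_point A P.
Proof.
move=> qA; pose l := (Num.sqrt (qform t A))^-1.
have l1 : qform t (l *: A) == 1.
  by rewrite qformZ exprVn sqr_sqrtr ?(ltW qA)// mulVf// gt_eqF.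
exists (\pi_(geom t) (exist _ (l *: A) l1)); exists (exist _ (l *: A) l1).
by split=> //; exists l => //; rewrite invr_gt0 sqrtr_gt0.
Qed.

(** The positive factor that brings a vector into the model is the inverse square root of its
    [qform], and the forms are homogeneous. *)
Lemma geom_dist_ray (R : realType) (t : R) (A B : 'rV[R]_3) (P Q : geom t) :
  ray_point A P -> ray_point B Q ->
  geom_dist P Q = carccos
    (`|bform t A B| / (Num.sqrt (qform t A) * Num.sqrt (qform t B)))%:C.
Proof.
have sqrt_ray (C : 'rV[R]_3) (s : model t) l : 0 < l -> val s = l *: C ->
    (Num.sqrt (qform t C))^-1 = l.
  move=> l_gt0 sC; have /eqP := svalP s; rewrite sC qformZ => lC.
  have -> : qform t C = l^-1 ^+ 2.
    by apply: (mulfI (lt0r_neq0 (exprn_gt0 2 l_gt0))); rewrite lC; field; lra.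
  by rewrite sqrtr_sqr ger0_norm ?invrK// invr_ge0 ltW.
move=> [s [[k k_gt0 sA] ->]] [s' [[l l_gt0 sB] ->]].
rewrite geom_dist_abs sA sB bformZ invfM (sqrt_ray _ _ _ k_gt0 sA).
rewrite (sqrt_ray _ _ _ l_gt0 sB) !normrM (gtr0_norm k_gt0) (gtr0_norm l_gt0).
by congr (carccos _%:C); ring.
Qed.

Lemma lift0_ray (R : realType) (A : 'rV[R]_3) (P : geom 0) :
  ray_point A P -> A 0 2 != 0 /\ Defs.lift0 P = (A 0 2)^-1 *: A.
Proof.
move=> [s [[l l_gt0 sA] ->]].
have lA : (l * A 0 2) ^+ 2 = 1.
  by have /eqP := svalP s; rewrite sA /qform !mxE !mul0r !add0r.
have A2 : A 0 2 != 0
  by apply: contra_eq_neq lA => ->; rewrite mulr0 expr0n eq_sym oner_eq0.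
split=> //.
(* Here [l * A 0 2] is 1 or -1: it is the sign by which [lift0] moves the point to the plane z =
   1. *)
have -> : (A 0 2)^-1 = l * A 0 2 * l.
  by apply: (mulIf A2); rewrite mulVf// -lA; ring.
by rewrite /Defs.lift0; case: (repr_pi s) => ->; rewrite sA !mxE ?scalerN ?scaleNr
  ?opprK scalerA.
Qed.

Lemma normalized_dist_pos (R : realType) (t c : R) (P Q : geom t) :
  0 < t -> -1 <= c <= 1 -> geom_dist P Q = carccos c%:C ->
  normalized_dist P Q = (acos c / Num.sqrt `|t|)%:C.
Proof.
move=> t_gt0 c1 dE; rewrite /normalized_dist dE carccos_acos//.
rewrite sqrtc_sqrtr ?lecR ?ltW//= gtr0_norm// mulrC mul1r.
by rewrite rmorphM/= fmorphV.
Qed.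

(** The square root of [t] and the arc cosine of [c] are both ['i] times a real number, so the
    quotient is real. *)
Lemma normalized_dist_neg (R : realType) (t c : R) (P Q : geom t) :
  t < 0 -> 1 <= c -> geom_dist P Q = carccos c%:C ->
  normalized_dist P Q =
  (ln (c + Num.sqrt (c ^+ 2 - 1)) / Num.sqrt `|t|)%:C.
Proof.
move=> t_lt0 c1 dE; rewrite /normalized_dist dE carccos_arcosh//.
have -> : sqrtc t%:C = 'i * (Num.sqrt `|t|)%:C :> R[i].
  rewrite /sqrtc /= eqxx expr0n addr0 sqrtr_sqr ltr0_norm//= addNr mul0r sqrtr0.
  by rewrite (_ : (- t - t) / 2 = - t); [simpc|lra].
have s0 : (Num.sqrt `|t|)%:C != 0 :> R[i].
  by rewrite fmorph_eq0 gt_eqF// sqrtr_gt0 normr_gt0 lt_eqF.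
have i0 : 'i != 0 :> R[i] by rewrite eq_complex/= oner_eq0 andbF.
rewrite [in RHS]rmorphM/= fmorphV.
by field; rewrite i0 s0.
Qed.

(** * The cosine and the chord near t = 0, and the two one-sided limits *)

(* Cosine of the angle at parameter t between the directions (a, 1) and (b, 1),
   in terms of p = |a|^2, q = |b|^2 and m = <a, b>. *)
Definition ray_cos (R : realType) (p q m t : R) : R :=
  `|1 + t * m| / (Num.sqrt (1 + t * p) * Num.sqrt (1 + t * q)).

(* The quantity w such that 1 - c^2 = t w^2, for c = [ray_cos p q m t]. *)
Definition ray_chord (R : realType) (p q m t : R) : R :=
  Num.sqrt ((p + q - 2 * m + t * (p * q - m ^+ 2)) /
            ((1 + t * p) * (1 + t * q))).

Lemma cvg_affine0 (R : realType) (x y : R) : x + t * y @[t --> (0 : R)] --> x.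
Proof.
rewrite -[X in _ --> X]addr0 -[X in _ --> _ + X](mul0r y).
by apply: cvgD; [exact: cvg_cst|apply: cvgM; [exact: cvg_id|exact: cvg_cst]].
Qed.

Lemma cvg_sqrtr (R : realType) (T : Type) (F : set_system T)
    (FF : Filter F) (f : T -> R) (l : R) :
  f @ F --> l -> Num.sqrt (f x) @[x --> F] --> Num.sqrt l.
Proof. by move=> fl; apply: continuous_cvg => //; exact: sqrt_continuous. Qed.

Lemma cvg_ray_cos (R : realType) (p q m : R) :
  ray_cos p q m t @[t --> (0 : R)] --> (1 : R).
Proof.
rewrite [X in _ --> X](_ : _ = `|1| / (Num.sqrt 1 * Num.sqrt 1)).
  apply: cvgM; first by apply: cvg_norm; exact: cvg_affine0.
  apply: cvgV; first by rewrite sqrtr1 mulr1 oner_eq0.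
  by apply: cvgM; apply: cvg_sqrtr; exact: cvg_affine0.
by rewrite sqrtr1 normr1 mulr1 divr1.
Qed.

Lemma cvg_ray_chord (R : realType) (p q m : R) :
  ray_chord p q m t @[t --> (0 : R)] --> Num.sqrt (p + q - 2 * m).
Proof.
apply: cvg_sqrtr.
rewrite [X in _ --> X](_ : _ = (p + q - 2 * m) / (1 * 1)); last first.
  by rewrite mulr1 divr1.
apply: cvgM; first exact: cvg_affine0.
apply: cvgV; first by rewrite mulr1 oner_eq0.
by apply: cvgM; exact: cvg_affine0.
Qed.

Lemma near_affine_gt0 (R : realType) (x y : R) : 0 < x ->
  \forall t \near (0 : R), 0 < x + t * y.
Proof. by move=> x_gt0; exact: cvgr_gt (@cvg_affine0 R x y) _ x_gt0. Qed.

(** This is (1 + t p) (1 + t q) - (1 + t m)^2 = t (p + q - 2 m + t (p q - m^2)), divided by the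
    first product. Small [t] keeps the denominators positive and the radicand nonnegative. *)
Lemma ray_cos_chord (R : realType) (p q m : R) : 0 <= p -> 0 <= q ->
  m ^+ 2 <= p * q ->
  \forall t \near (0 : R), ray_cos p q m t ^+ 2 + t * ray_chord p q m t ^+ 2 = 1.
Proof.
move=> p_ge0 q_ge0 mpq.
have D_ge0 : 0 <= p + q - 2 * m.
  rewrite subr_ge0; have [m_le0|m_gt0] := lerP m 0; first lra.
  (* Compare squares: 4 m^2 <= 4 p q <= (p + q)^2. *)
  rewrite -(@ler_pXn2r _ 2)// ?nnegrE; [|lra|lra].
  have := sqr_ge0 (p - q); nra.
(* For t < 0 and a = b the radicand is nonnegative because the Cauchy-Schwarz
   defect vanishes too. *)
have num_ge0 : \forall t \near (0 : R), 0 <= p + q - 2 * m + t * (p * q - m ^+ 2).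
  have [D_gt0|D_le0] := ltP 0 (p + q - 2 * m).
    apply: (filterS _ (@near_affine_gt0 R _ (p * q - m ^+ 2) D_gt0)) => t.
    exact: ltW.
  have mE : m = (p + q) / 2 by lra.
  have -> : p * q - m ^+ 2 = 0.
    apply/le_anti; rewrite subr_ge0 mpq andbT mE.
    have := sqr_ge0 (p - q); nra.
  by near=> t; rewrite mulr0 addr0.
near=> t.
have P_gt0 : 0 < 1 + t * p by near: t; exact: near_affine_gt0.
have Q_gt0 : 0 < 1 + t * q by near: t; exact: near_affine_gt0.
rewrite /ray_cos /ray_chord sqr_sqrtr; last first.
  by rewrite divr_ge0 ?mulr_ge0 ?(ltW P_gt0) ?(ltW Q_gt0)//; near: t.
rewrite exprMn exprVn exprMn !sqr_sqrtr ?(ltW P_gt0) ?(ltW Q_gt0)//.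
rewrite real_normK ?num_real//.
by field; rewrite !gt_eqF.
Unshelve. all: by end_near. Qed.

Lemma cvg_normalized_dist (R : realType) (p q m : R) (P Q : forall t : R, geom t) :
  0 <= p -> 0 <= q -> m ^+ 2 <= p * q ->
  (\forall t \near (0 : R),
     geom_dist (P t) (Q t) = carccos (ray_cos p q m t)%:C) ->
  (normalized_dist (P t) (Q t) : R[i]^o) @[t --> (0 : R)^'+]
      --> ((Num.sqrt (p + q - 2 * m))%:C : R[i]^o) /\
  (normalized_dist (P t) (Q t) : R[i]^o) @[t --> (0 : R)^'-]
      --> ((Num.sqrt (p + q - 2 * m))%:C : R[i]^o).
Proof.
move=> p_ge0 q_ge0 mpq dE.
have cw := ray_cos_chord p_ge0 q_ge0 mpq.
have c_ge0 t : 0 <= ray_cos p q m t by rewrite divr_ge0 ?mulr_ge0 ?sqrtr_ge0.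
have w_ge0 t : 0 <= ray_chord p q m t by exact: sqrtr_ge0.
(* One real scale serves both sides: its square is [t] on the right and [- t] on the left. *)
have r0 : Num.sqrt `|t| @[t --> (0 : R)] --> (0 : R).
  rewrite -[X in _ --> X]sqrtr0 -[X in _ --> Num.sqrt X](normr0 R).
  by apply: cvg_sqrtr; apply: cvg_norm; exact: cvg_id.
split.
- have : acos (ray_cos p q m t) / Num.sqrt `|t| @[t --> (0 : R)^'+]
      --> Num.sqrt (p + q - 2 * m).
    apply: (@cvg_acos_div _ _ _ _ _ _ (ray_chord p q m)).
    + by near=> t; rewrite sqrtr_gt0 normr_gt0 gt_eqF.
    + by near=> t.
    + near=> t; rewrite [(Num.sqrt _ * _) ^+ 2]exprMn sqr_sqrtr// gtr0_norm//.
      by near: t; exact: cvg_within.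
    + exact: cvg_at_right_filter.
    + by apply: cvg_at_right_filter; exact: cvg_ray_cos.
    + by apply: cvg_at_right_filter; exact: cvg_ray_chord.
  move/cvg_real_complex; apply: cvg_trans; apply: near_eq_cvg.
  near=> t.
  have t_gt0 : 0 < t by [].
  rewrite (@normalized_dist_pos _ _ (ray_cos p q m t))//.
    have cE : ray_cos p q m t ^+ 2 + t * ray_chord p q m t ^+ 2 = 1.
      by near: t; exact: cvg_within.
    (* The relation c^2 = 1 - t w^2 puts [c] in the domain of the real arc cosine. *)
    have := c_ge0 t; have := sqr_ge0 (ray_chord p q m t); nra.
  by near: t; exact: cvg_within.
- have : ln (ray_cos p q m t + Num.sqrt (ray_cos p q m t ^+ 2 - 1)) /
      Num.sqrt `|t| @[t --> (0 : R)^'-] --> Num.sqrt (p + q - 2 * m).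
    apply: (@cvg_arcosh_div _ _ _ _ _ _ (ray_chord p q m)).
    + by near=> t; rewrite sqrtr_gt0 normr_gt0 lt_eqF.
    + by near=> t.
    + near=> t; rewrite [(Num.sqrt _ * _) ^+ 2]exprMn sqr_sqrtr// ltr0_norm// mulNr.
      by apply/eqP; rewrite -subr_eq opprK; apply/eqP; near: t; exact: cvg_within.
    + exact: cvg_at_left_filter.
    + by apply: cvg_at_left_filter; exact: cvg_ray_cos.
    + by apply: cvg_at_left_filter; exact: cvg_ray_chord.
  move/cvg_real_complex; apply: cvg_trans; apply: near_eq_cvg.
  near=> t.
  have t_lt0 : t < 0 by [].
  rewrite (@normalized_dist_neg _ _ (ray_cos p q m t))//.
    have cE : ray_cos p q m t ^+ 2 + t * ray_chord p q m t ^+ 2 = 1.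
      by near: t; exact: cvg_within.
    (* Now [t < 0], so the same relation gives c >= 1, the hyperbolic case. *)
    have := c_ge0 t; have := sqr_ge0 (ray_chord p q m t); nra.
  by near: t; exact: cvg_within.
Unshelve. all: by end_near. Qed.

(** * Reduction to the plane z = 1 and conclusion *)

Lemma qform_slopes (R : realType) (t : R) (A : 'rV[R]_3) : A 0 2 != 0 ->
  qform t A = A 0 2 ^+ 2 * (1 + t * ((A 0 0 / A 0 2) ^+ 2 + (A 0 1 / A 0 2) ^+ 2)).
Proof. by move=> A2; rewrite /qform; field. Qed.

(** The heights [A 0 2] and [B 0 2] factor out in absolute value, so rays pointing to z = -1 need no
    separate case. *)
Lemma ray_cos_slopes (R : realType) (t : R) (A B : 'rV[R]_3) :
  A 0 2 != 0 -> B 0 2 != 0 ->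
  `|bform t A B| / (Num.sqrt (qform t A) * Num.sqrt (qform t B)) =
  ray_cos ((A 0 0 / A 0 2) ^+ 2 + (A 0 1 / A 0 2) ^+ 2)
          ((B 0 0 / B 0 2) ^+ 2 + (B 0 1 / B 0 2) ^+ 2)
          (A 0 0 / A 0 2 * (B 0 0 / B 0 2) + A 0 1 / A 0 2 * (B 0 1 / B 0 2)) t.
Proof.
move=> A2 B2; rewrite /ray_cos !qform_slopes//.
rewrite (sqrtrM _ (sqr_ge0 (A 0 2))) (sqrtrM _ (sqr_ge0 (B 0 2))) !sqrtr_sqr.
have -> : bform t A B = A 0 2 * B 0 2 *
    (1 + t * (A 0 0 / A 0 2 * (B 0 0 / B 0 2) + A 0 1 / A 0 2 * (B 0 1 / B 0 2))).
  by rewrite bformE; field; rewrite A2 B2.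
rewrite normrM [`|A 0 2 * _|]normrM [X in _ / X]mulrACA -mulf_div divff ?mul1r//.
by rewrite mulf_neq0 ?normr_eq0.
Qed.

Theorem proposition5p1 (R : realType) (A B : 'rV[R]_3)
    (A_ B_ : forall t : R, geom t)
    (hA0 : ray_point A (A_ 0)) (hB0 : ray_point B (B_ 0))
    (hA : forall t : R, -1 <= t <= 1 ->
       (exists P : geom t, ray_point A P) -> ray_point A (A_ t))
    (hB : forall t : R, -1 <= t <= 1 ->
       (exists P : geom t, ray_point B P) -> ray_point B (B_ t)) :
  (normalized_dist (A_ t) (B_ t) : R[i]^o) @[t --> (0 : R)^'+]
      --> ((euclid_dist0 (A_ 0) (B_ 0))%:C : R[i]^o) /\
  (normalized_dist (A_ t) (B_ t) : R[i]^o) @[t --> (0 : R)^'-]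
      --> ((euclid_dist0 (A_ 0) (B_ 0))%:C : R[i]^o).
Proof.
have [A2 liftA] := lift0_ray hA0; have [B2 liftB] := lift0_ray hB0.
pose slope (C : 'rV[R]_3) (i : 'I_3) := C 0 i / C 0 2.
pose p (C : 'rV[R]_3) := slope C 0 ^+ 2 + slope C 1 ^+ 2.
pose m := slope A 0 * slope B 0 + slope A 1 * slope B 1.
have p_ge0 C : 0 <= p C by rewrite addr_ge0 ?sqr_ge0.
have -> : euclid_dist0 (A_ 0) (B_ 0) = Num.sqrt (p A + p B - 2 * m).
  have sum3 (F : 'I_3 -> R) : \sum_(i < 3) F i = F 0 + F 1 + F 2.
    rewrite !big_ord_recr big_ord0 /= add0r.
    by congr (F _ + F _ + F _); exact: val_inj.
  rewrite /euclid_dist0 liftA liftB sum3 !mxE !mulVf//.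
  by congr Num.sqrt; rewrite /p /m /slope; ring.
(* As [t] tends to 0, [qform t C] tends to the positive number [C 0 2 ^+ 2], so the ray meets the
   model for all small [t]. *)
have ray_near (C : 'rV[R]_3) (C_ : forall t : R, geom t) : C 0 2 != 0 ->
    (forall t : R, -1 <= t <= 1 ->
       (exists P : geom t, ray_point C P) -> ray_point C (C_ t)) ->
    \forall t \near (0 : R), ray_point C (C_ t).
  move=> C2 hC; near=> t; apply: hC.
    rewrite -ler_norml; near: t.
    exact: (@nbhs0_le _ R (1 : R) ltr01).
  apply: ray_point_ex; rewrite qform_slopes// mulr_gt0//.
    by rewrite exprn_even_gt0.
  by near: t; exact: near_affine_gt0.
apply: (cvg_normalized_dist (p_ge0 A) (p_ge0 B)).
  (* Lagrange's identity: this square is [p A * p B - m ^+ 2]. *)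
  have := sqr_ge0 (slope A 0 * slope B 1 - slope A 1 * slope B 0).
  by rewrite /p /m; nra.
near=> t.
rewrite -ray_cos_slopes//; apply: geom_dist_ray; near: t.
  exact: ray_near A2 hA.
exact: ray_near B2 hB.
Unshelve. all: by end_near. Qed.
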